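(* Every directed acyclic graph $D=(V,A)$ on $n$ vertices admits a directed intersection representation. Moreover, $$\mathrm{DIN}(n)\le \frac{5}{8}n^2-\frac{1}{4}n .$$
   Context: In a digraph $D=(V,A)$ with vertex set $V$ and arc set $A$, an arc $(u,v)\in A$ has tail $u$ and head $v$. A directed acyclic graph (DAG) is a digraph with no directed cycles. A directed intersection representation of a digraph $D=(V,A)$ is an assignment $\varphi$ of a nonempty subset $\varphi(v)\subseteq\mathcal{C}$ of a finite ground set $\mathcal{C}$ (the color set) to each vertex $v\in V$ such that $(u,v)\in A$ if and only if $|\varphi(u)\cap\varphi(v)|\ge 1$ and $|\varphi(u)|<|\varphi(v)|$. The directed intersection number $\mathrm{DIN}(D)$ is the smallest cardinality of a ground set $\mathcal{C}$ that allows for a directed intersection representation of $D$. Here $\mathrm{DIN}(n)$ denotes the largest value of $\mathrm{DIN}(D)$ over all DAGs $D$ on $n$ vertices, so the bound says that every DAG $D$ on $n$ vertices has $\mathrm{DIN}(D)\le \frac{5}{8}n^2-\frac{1}{4}n$.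
   Formalization: The bound on DIN(n) is stated for every n other than 1, since the one-vertex digraph needs a nonempty color set, so DIN(1) = 1 > 3/8 and the printed bound fails there; existence of a representation is still stated for all DAGs. *)

(* Defs.v *)
From mathcomp Require Import all_boot all_order all_algebra.
From mathcomp Require Import boolp.

Set Implicit Arguments.
Unset Strict Implicit.
Unset Printing Implicit Defensive.

(* A digraph on the vertex set V is given by its arc set A : {set V * V};
   the pair (u, v) has tail u and head v. *)

(* Loops and pairs of opposite arcs are directed cycles, of length 1 and 2. *)
Definition acyclic (V : finType) (A : {set V * V}) : Prop :=
  forall c : seq V, ucycle [rel u v | (u, v) \in A] c -> c = [::].

Definition directed_intersection_rep (V C : finType) (A : {set V * V})
    (phi : V -> {set C}) : Prop :=
  (forall v, phi v != set0) /\
  (forall u v, (u, v) \in A <->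
     1 <= #|phi u :&: phi v| /\ #|phi u| < #|phi v|).

Definition representable (V : finType) (A : {set V * V}) (k : nat) : Prop :=
  exists C : finType, #|C| = k /\
  exists phi : V -> {set C}, directed_intersection_rep A phi.

(* The value is 0 by convention when A has no representation at all. *)
Definition DIN (V : finType) (A : {set V * V}) : nat :=
  match pselect (exists k, `[< representable A k >]) with
  | left ex_k => ex_minn ex_k
  | right _ => 0
  end.

(* DIN is invariant under isomorphism, so the vertex set 'I_n loses no
   generality.  As colour sets are nonempty, DIN_max 1 = 1. *)
Definition DIN_max (n : nat) : nat :=
  \max_(A : {set 'I_n * 'I_n} | `[< acyclic A >]) DIN A.

(* Main.v *)
Require Import Defs.
From mathcomp Require Import all_boot all_order all_algebra.
From mathcomp Require Import boolp zify lra.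
Import Order.TTheory GRing.Theory Num.Theory.

Set Implicit Arguments.
Unset Strict Implicit.
Unset Printing Implicit Defensive.

(** Arrange the n vertices of the DAG in a topological order and cut the order
into blocks of two consecutive vertices, the very first vertex being left
alone when n is odd.  With M blocks this makes n = 2M - o, where o is 0 or 1.

Every vertex u and every block j after the block of u get a colour (j, inl u),
held by u and by the out-neighbours of u in block j.  This colour serves both
possible arcs from u into block j, and two vertices of different blocks share a
colour exactly when there is an arc between them.  Besides, every block has
padding colours (j, inr t), which only its own two vertices use and which they
share as far as possible: each takes an initial segment.  Sharing inside a
block is harmless, because if the block carries no arc its two vertices are
given the same number of colours, and then a common colour produces no arc.

A vertex of block b ends up with exactly M + 2b + e - 2o colours, with e = 0 if
it has an out-arc inside its block and e = 1 otherwise (card_colours).  These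
sizes increase strictly from each block to the next and along an arc inside a
block, so that colours_rep holds.  The padding is long enough: a vertex of
block b has M - 1 - b colours of its own towards later blocks and at most
2b - o colours from earlier vertices.  For even n this leaves
at least b + 1 colours to be filled by padding, and at most 3b + 2.

There are at most 2j - o earlier vertices for block j, and block j needs
3j + 2 - 2o padding colours.  Summing 5j + 2 - 3o over the blocks gives
M(5M - 1)/2 for o = 0, and (M - 1)(5M - 2)/2 for o = 1 (where block 0
contributes no colour at all, the subtraction 2j - o being truncated);
with M = n/2, respectively M = (n + 1)/2, neither exceeds 5n^2/8 - n/4
(palette_bound). *)

(** * Topological order *)

Section LinearExtension.
Variables (V : finType) (A : {set V * V}).

Let e := [rel u v | (u, v) \in A].

Lemma acyclic_connectN u v :
  acyclic A -> (u, v) \in A -> ~~ connect e v u.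
Proof.
move=> acA uvA; apply/negP => /connectP[p pth ulast].
case/shortenP: pth ulast => p' pth' un _ ulast.
suff /acA : ucycle e (v :: p') by [].
by rewrite /ucycle un andbT /= rcons_path pth' -ulast.
Qed.

(** The number of vertices from which v is reachable increases along arcs by
acyclicity; the enumeration of V breaks the ties. *)
Lemma acyclic_ranking (acA : acyclic A) :
  exists key : V -> nat, injective key /\
    (forall u v, (u, v) \in A -> key u < key v).
Proof.
pose r v := #|[set u | connect e u v]|.
exists (fun v => r v * #|V| + enum_rank v); split=> [u v | u v uvA].
  move=> /(congr1 (modn^~ #|V|)); rewrite !modnMDl !modn_small //.
  by move=> /val_inj/enum_rank_inj.
have lt_r : r u < r v.
  apply/proper_card/properP; split.
    apply/subsetP=> w; rewrite !inE => wu.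
    exact: connect_trans wu (connect1 uvA).
  by exists v; rewrite !inE ?connect0 // acyclic_connectN.
apply: leq_trans (leq_addr _ _); apply: leq_trans (leq_mul lt_r (leqnn _)).
by rewrite mulSn addnC ltn_add2r.
Qed.

(** Replacing each key by its rank among all keys makes the values fill
0, ..., #|V| - 1. *)
Lemma acyclic_topological_order (acA : acyclic A) :
  exists f : V -> nat, [/\ injective f, forall v, f v < #|V| &
    forall u v, (u, v) \in A -> f u < f v].
Proof.
have [key [key_inj key_lt]] := acyclic_ranking acA.
pose f v := #|[set u | key u < key v]|.
have f_lt u v : key u < key v -> f u < f v.
  move=> uv; apply/proper_card/properP; split.
    by apply/subsetP=> w; rewrite !inE => /ltn_trans->.
  by exists u; rewrite !inE ?ltnn.
exists f; split=> [u v fuv | v | u v /key_lt/f_lt //].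
  by apply: key_inj; case: (ltngtP (key u) (key v)) => // /f_lt; lia.
rewrite -cardsT; apply/proper_card/properP; split; first exact: subsetT.
by exists v; rewrite !inE ?ltnn.
Qed.

End LinearExtension.

(** * Counting lemmas *)

Lemma card_preim_interval (V : finType) (f : V -> nat) (a b : nat) :
  injective f -> (forall v, a <= f v) -> #|[set v | f v < b]| <= b - a.
Proof.
move=> f_inj fge; rewrite cardE -(size_map f) -(size_iota a (b - a)).
apply: uniq_leq_size; first by rewrite (map_inj_uniq f_inj) enum_uniq.
move=> x /mapP[v]; rewrite mem_enum inE => vb ->.
by rewrite mem_iota; have := fge v; lia.
Qed.

Lemma card_ord_lt (K k : nat) : k <= K -> #|[set t : 'I_K | t < k]| = k.
Proof.
by move=> kK; rewrite -sum1dep_card (big_ord_narrow kK) sum1_card card_ord.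
Qed.

Lemma card_ord_gt (M : nat) (i : 'I_M) : #|[set j : 'I_M | i < j]| = M - i.+1.
Proof.
have -> : [set j : 'I_M | i < j] = ~: [set j : 'I_M | j < i.+1].
  by apply/setP=> j; rewrite !inE ltnS -ltnNge.
by rewrite cardsCs setCK card_ord card_ord_lt.
Qed.

(** * Restricting the colour set *)

(** Lets the construction live in a conveniently large colour type, of which
only the colours in S are charged. *)
Lemma representable_on (V C : finType) (A : {set V * V}) (phi : V -> {set C})
    (S : {set C}) :
  directed_intersection_rep A phi -> (forall v, phi v \subset S) ->
  representable A #|S|.
Proof.
move=> [phi0 phiA] phiS; exists {c | c \in S}.
split; first by rewrite card_sig; apply: eq_card.
pose f (c : {c | c \in S}) := val c.
have cardf (B : {set C}) : B \subset S -> #|f @^-1: B| = #|B|.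
  move=> BS; rewrite -(card_imset _ (val_inj : injective f)).
  apply: eq_card => c; apply/imsetP/idP => [[d] | cB].
    by rewrite inE => dB ->.
  by exists (Sub c (subsetP BS _ cB)); rewrite ?inE.
exists (fun v => f @^-1: phi v); split=> [v | u v].
  by rewrite -card_gt0 cardf // card_gt0.
rewrite -preimsetI !cardf //; exact: subset_trans (subsetIl _ _) (phiS u).
Qed.

Lemma DIN_le (V : finType) (A : {set V * V}) k :
  representable A k -> DIN A <= k.
Proof.
move=> Ak; rewrite /DIN; case: pselect => [ex_k | []]; last first.
  by exists k; apply/asboolP.
by case: ex_minnP => m _; apply; apply/asboolP.
Qed.

(** * Closed forms for the number of colours *)

Lemma sum_even M :
  2 * (\sum_(j < M) (j.*2 - 0 + (3 * j + 2 - 2 * 0))) = M * (5 * M - 1).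
Proof.
elim: M => [|M IH]; first by rewrite big_ord0.
rewrite big_ord_recr /= mulnDr IH; nia.
Qed.

Lemma sum_odd m :
  2 * (\sum_(j < m.+1) (j.*2 - 1 + (3 * j + 2 - 2 * 1))) = m * (5 * m + 3).
Proof.
elim: m => [|m IH]; first by rewrite big_ord_recr big_ord0.
rewrite big_ord_recr /= mulnDr IH; nia.
Qed.

(** * The colouring by blocks of two *)

Section Construction.
Variables (V : finType) (A : {set V * V}) (pos : V -> nat) (o M : nat).
(* Positions start at o, which is the parity of n in the sharp bound: this
   leaves the first vertex alone in block 0 when n is odd. *)
Hypotheses (pos_inj : injective pos) (pos_ge : forall v, o <= pos v)
  (pos_lt : forall v, pos v < M.*2)
  (pos_arc : forall u v, (u, v) \in A -> pos u < pos v)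
  (o_le1 : o <= 1) (M_gt : o < M).

Lemma block_subproof v : (pos v)./2 < M.
Proof. by rewrite ltn_half_double. Qed.

Definition block v : 'I_M := Ordinal (block_subproof v).

(** The number of padding colours of block j: the value of own_pad at
a top of block j that has no in-neighbour in an earlier block. *)
Definition npad j := 3 * j + 2 - 2 * o.

Definition earlier_in v := [set u | block u < block v & (u, v) \in A].

(** A second vertex of a block is always a top; a first vertex is one precisely
when it may receive the same number of colours as the second. *)
Definition is_top v := ~~ [exists w, (block w == block v) && ((v, w) \in A)].

(** The number of padding colours that brings the total at v to the value of
card_colours. *)
Definition own_pad v := 3 * block v + 1 + is_top v - 2 * o - #|earlier_in v|.

(** The first component is the block that owns the colour; 3 * M + 2 is merely
a common upper bound for the npad j. *)
Definition colour := ('I_M * (V + 'I_(3 * M + 2)))%type.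

Definition out_colours v : {set colour} :=
  [set (j, inl v) | j : 'I_M & block v < j].
Definition in_colours v : {set colour} :=
  [set (block v, inl u) | u in earlier_in v].
Definition pad_colours v : {set colour} :=
  [set (block v, inr t) | t : 'I_(3 * M + 2) & t < own_pad v].

Definition colours v := out_colours v :|: in_colours v :|: pad_colours v.

Definition palette : {set colour} :=
  \bigcup_(j < M) ([set (j, inl v) | v : V & block v < j] :|:
                   [set (j, inr t) | t : 'I_(3 * M + 2) & t < npad j]).

Lemma card_earlier (j : nat) : #|[set v | block v < j]| <= j.*2 - o.
Proof.
have -> : [set v | block v < j] = [set v | pos v < j.*2].
  by apply/setP=> v; rewrite !inE /=; lia.
exact: card_preim_interval.
Qed.

Lemma card_earlier_in v : #|earlier_in v| <= (block v).*2 - o.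
Proof.
apply: leq_trans (card_earlier (block v)).
by apply/subset_leq_card/subsetP=> u; rewrite !inE => /andP[].
Qed.

(** The lonely first vertex of an odd order has no partner to send an arc to. *)
Lemma top_of_pos1 v : pos v = 1 -> o = 1 -> is_top v.
Proof.
move=> pv o1; apply/existsP => -[w /andP[/eqP/(congr1 val) /= bw /pos_arc]].
lia.
Qed.

(** The subtraction in own_pad is a genuine one. *)
Lemma own_pad_slack v : #|earlier_in v| + 2 * o <= 3 * block v + 1 + is_top v.
Proof.
have := card_earlier_in v; have := pos_ge v; have := @top_of_pos1 v.
case: (is_top v) => /=; lia.
Qed.

(** The value is independent of the arcs between blocks: colours towards later
blocks are present whether or not an arc uses them, and the padding makes up for
the vertices of earlier blocks that are not in-neighbours of v. *)
Lemma card_colours v : #|colours v| = M + 2 * block v + is_top v - 2 * o.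
Proof.
have cO : #|out_colours v| = M - (block v).+1.
  by rewrite card_imset ?card_ord_gt // => i j [].
have cI : #|in_colours v| = #|earlier_in v|.
  by rewrite card_imset // => i j [].
have cP : #|pad_colours v| = own_pad v.
  rewrite card_imset; last by move=> i j [].
  rewrite card_ord_lt //; have := ltn_ord (block v); rewrite /own_pad; lia.
have dOI : out_colours v :&: in_colours v = set0.
  apply/setP=> c; rewrite !inE; apply/andP=> -[/imsetP[j]].
  by rewrite inE => jv -> /imsetP[u _ [jE _]]; rewrite jE ltnn in jv.
have dP : (out_colours v :|: in_colours v) :&: pad_colours v = set0.
  apply/setP=> c; rewrite !inE; apply/andP=> -[] /[swap] /imsetP[t _ ->].
  by case/orP=> /imsetP[].
rewrite !cardsU dP dOI cards0 !subn0 cO cI cP /own_pad.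
have := own_pad_slack v; have := ltn_ord (block v); lia.
Qed.

Lemma colours_neq0 v : colours v != set0.
Proof.
rewrite -card_gt0 card_colours.
have := pos_ge v; have := @top_of_pos1 v; case: (is_top v) => /=; lia.
Qed.

Lemma pos_half u v : block u = block v -> pos u < pos v ->
  pos v = (block v).*2.+1.
Proof. move=> /(congr1 val) /=; lia. Qed.

(** Across blocks the tail provides the shared colour and sizes grow with the
block.  Inside a block the first padding colour is shared, and the tail is one
colour short of the head because it is not a top. *)
Lemma arc_colours u v : (u, v) \in A ->
  1 <= #|colours u :&: colours v| /\ #|colours u| < #|colours v|.
Proof.
move=> uv; have puv := pos_arc uv.
have [buv | bvu | buv] := ltngtP (block u) (block v).
- split; last first.
    rewrite !card_colours; have := @top_of_pos1 v; have := pos_ge u.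
    move: buv; case: (is_top u); case: (is_top v) => /=; lia.
  apply/card_gt0P; exists (block v, inl u); rewrite !inE; apply/andP; split.
    by rewrite imset_f ?inE.
  by rewrite (imset_f (fun u => (block v, inl u))) ?orbT // inE buv uv.
- by move: bvu => /=; lia.
have {}buv : block u = block v by apply: val_inj.
have utop : is_top u = false by apply/existsP; exists v; rewrite buv eqxx.
have vtop : is_top v = true.
  apply/existsP => -[w /andP[/eqP bw /pos_arc pvw]].
  have := pos_half buv puv; have := pos_half (esym bw) pvw; rewrite bw; lia.
(* A block containing an arc is full, hence not the lonely first block. *)
have bo : o <= block v.
  by have := pos_ge u; move: buv => /(congr1 val) /=; lia.
split; last by rewrite !card_colours utop vtop buv /=; lia.
have pad_gt0 w : block w = block v -> 0 < own_pad w.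
  by move=> bw; have := card_earlier_in w; rewrite /own_pad bw; lia.
pose t0 : 'I_(3 * M + 2) := Ordinal (ltn_addl (3 * M) (isT : 0 < 2)).
apply/card_gt0P; exists (block v, inr t0); rewrite !inE; apply/andP; split.
  by rewrite -buv (imset_f (fun t => (block u, inr t))) ?orbT // inE pad_gt0.
by rewrite (imset_f (fun t => (block v, inr t))) ?orbT // inE pad_gt0.
Qed.

Lemma coloursP c v : c \in colours v ->
  [\/ exists2 j : 'I_M, block v < j & c = (j, inl v),
      exists2 u, u \in earlier_in v & c = (block v, inl u) |
      exists t, c = (block v, inr t)].
Proof.
rewrite !inE => /orP[/orP[]|] /imsetP[x]; rewrite ?inE => xP ->.
- by constructor 1; exists x.
- by constructor 2; exists x; rewrite ?inE.
- by constructor 3; exists x.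
Qed.

(** Across blocks, only the colours (block v, inl u) with (u, v) an arc can be
shared.  Inside a block, unequal sizes mean that u is not a top, so that it
sends an arc to the only other vertex of the block. *)
Lemma arc_of_colours u v : 1 <= #|colours u :&: colours v| ->
  #|colours u| < #|colours v| -> (u, v) \in A.
Proof.
case/card_gt0P=> c /setIP[cu cv] lt_uv.
have [buv | bvu | buv] := ltngtP (block u) (block v).
- have /eqP buv' : block u != block v by rewrite -val_eqE /= neq_ltn buv.
  have uv : u <> v by move=> uv; rewrite uv ltnn in buv.
  (* A common colour that is own to u and incoming at v yields the arc; every
     other coincidence forces u = v or contradicts the order of the blocks. *)
  case/coloursP: cv => [[j _ ->]|[w wv ->]|[t ->]] in cu;
  case/coloursP: cu => [[j' ? []]|[w' w'u []]|[t' []]] //.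
  + by move=> _ /esym.
  + move=> _ E; move: w'u; rewrite -E inE; lia.
  + by move=> _ <-; move: wv; rewrite inE => /andP[].
  + by move=> /esym bE; case: buv'; apply: val_inj.
  + by move=> /esym bE; case: buv'; apply: val_inj.
- exfalso; move: lt_uv; rewrite !card_colours.
  move: bvu; case: (is_top u); case: (is_top v) => /=; lia.
have {}buv : block u = block v by apply: val_inj.
have : is_top u = false.
  move: lt_uv; rewrite !card_colours buv.
  by case: (is_top u); case: (is_top v) => //=; lia.
move/negbFE/existsP=> [w /andP[/eqP bw uw]].
suff -> : v = w by [].
apply: pos_inj; have puw := pos_arc uw.
have uv : pos u <> pos v by move=> /pos_inj E; rewrite E ltnn in lt_uv.
move: buv bw => /(congr1 val) /= ? /(congr1 val) /=; lia.
Qed.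

Lemma colours_rep : directed_intersection_rep A colours.
Proof.
split=> [|u v]; first exact: colours_neq0.
by split=> [/arc_colours|[]]; last exact: arc_of_colours.
Qed.

Lemma colours_sub v : colours v \subset palette.
Proof.
apply/subsetP=> c; rewrite !inE => /orP[/orP[]|] /imsetP[x xP ->];
  apply/bigcupP.
- exists x => //; rewrite inE (imset_f (fun v => (x, inl v))) //.
  by move: xP; rewrite !inE.
- exists (block v) => //; rewrite inE (imset_f (fun u => (block v, inl u))) //.
  by move: xP; rewrite !inE => /andP[].
- exists (block v) => //; rewrite inE.
  rewrite (imset_f (fun t => (block v, inr t))) ?orbT //.
  move: xP; rewrite !inE /own_pad /npad; case: (is_top v) => /=; lia.
Qed.

Lemma card_palette : #|palette| <= \sum_(j < M) (j.*2 - o + npad j).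
Proof.
rewrite /palette; elim/big_ind2: _ => [|b B c C Bb Cc|j _].
- by rewrite cards0.
- exact: leq_trans (leq_card_setU B C) (leq_add Bb Cc).
apply: leq_trans (leq_card_setU _ _) (leq_add _ _).
  apply: leq_trans (leq_imset_card _ _) _.
  exact: card_earlier.
apply: leq_trans (leq_imset_card _ _) _.
rewrite card_ord_lt //; have := ltn_ord j; rewrite /npad; lia.
Qed.

(** The number of vertices is M.*2 - o when positions fill the range. *)
Lemma palette_bound : 8 * #|palette| + 2 * (M.*2 - o) <= 5 * (M.*2 - o) ^ 2.
Proof.
suff H : 8 * (\sum_(j < M) (j.*2 - o + npad j)) + 2 * (M.*2 - o)
         <= 5 * (M.*2 - o) ^ 2.
  by apply: leq_trans H; rewrite leq_add2r leq_mul2l card_palette.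
rewrite /npad; clear -o_le1 M_gt.
case: o o_le1 M_gt => [|[|//]] _.
  by have := sum_even M; case: M => // m; rewrite expnS expn1; nia.
case: M => // m _; have := sum_odd m; rewrite expnS expn1; nia.
Qed.

End Construction.

(** * Existence and the bound *)

Lemma acyclic_representable (V : finType) (A : {set V * V}) :
  acyclic A -> exists C : finType, exists phi : V -> {set C},
    directed_intersection_rep A phi.
Proof.
move=> /acyclic_topological_order[f [f_inj f_lt f_arc]].
have [V0|V_gt0] := posnP #|V|.
  exists unit, (fun=> set0); split=> [v|u]; [have := f_lt v | have := f_lt u];
  by rewrite V0.
have f_ltM v : f v < #|V|.*2 by have := f_lt v; lia.
(* Using as many blocks as vertices and no shift covers a single vertex too. *)
exists (colour V #|V|), (colours A 0 f_ltM).
exact: colours_rep.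
Qed.

(** A shift by one requires two blocks: a single vertex alone in the only block
would receive no colour. *)
Lemma DIN_bound n (A : {set 'I_n * 'I_n}) :
  n != 1 -> acyclic A -> 8 * DIN A + 2 * n <= 5 * n ^ 2.
Proof.
move=> n1 /acyclic_topological_order[f [f_inj f_lt f_arc]].
rewrite card_ord in f_lt; have [n0|n_gt0] := posnP n.
  suff /DIN_le : representable A 0 by nia.
  exists void; rewrite card_void; split=> //; exists (fun=> set0).
  by split=> [v|u]; [have := f_lt v | have := f_lt u]; lia.
pose o : nat := odd n; pose M := uphalf n; pose pos v := f v + o.
have pos_inj : injective pos by move=> u v /addIn/f_inj.
have pos_ge v : o <= pos v by rewrite leq_addl.
have pos_lt v : pos v < M.*2 by have := f_lt v; rewrite /pos /o /M; lia.
have pos_arc u v : (u, v) \in A -> pos u < pos v.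
  by move=> /f_arc; rewrite ltn_add2r.
have o_le1 : o <= 1 by rewrite leq_b1.
have o_lt : o < M by rewrite /o /M; lia.
have nE : n = M.*2 - o by rewrite /o /M; lia.
suff : 8 * DIN A + 2 * (M.*2 - o) <= 5 * (M.*2 - o) ^ 2 by rewrite -nE.
apply: leq_trans (palette_bound pos_inj pos_ge pos_lt o_le1 o_lt).
rewrite leq_add2r leq_mul2l /=; apply: DIN_le.
apply: representable_on (colours_sub A pos_lt o_le1 o_lt).
exact: colours_rep.
Qed.

Local Open Scope ring_scope.

Theorem lemma2p1 :
  (forall (V : finType) (A : {set V * V}), acyclic A ->
     exists (C : finType) (phi : V -> {set C}),
       directed_intersection_rep A phi) /\
  (forall n : nat, n != 1%N ->
     (DIN_max n)%:R <= 5 / 8 * n%:R ^+ 2 - 1 / 4 * n%:R :> rat).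
Proof.
split=> [V A /acyclic_representable //|n n1].
have : (8 * DIN_max n + 2 * n <= 5 * n ^ 2)%N.
  rewrite /DIN_max; elim/big_ind: _ => [|x y Hx Hy|A /asboolP].
  - by nia.
  - by case: (leqP x y).
  - exact: DIN_bound.
rewrite -(ler_nat rat) !natrD !natrM; lra.
Qed.
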